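(* Let $(X,\tau_X,\mathfrak{a})$ and $(Y,\tau_Y,\mathfrak{b})$ be aura topological spaces and let $f:X\to Y$ be an $\mathfrak{a}$-continuous surjection. If $X$ is $\mathfrak{a}$-compact, then $Y$ is $\mathfrak{b}$-compact.
   Context: An aura topological space (or $\mathfrak{a}$-space) $(X,\tau,\mathfrak{a})$ is a topological space $(X,\tau)$ together with a function $\mathfrak{a}:X\to\tau$ (a scope function) such that $x\in\mathfrak{a}(x)$ for every $x\in X$. A subset $A\subseteq X$ is $\mathfrak{a}$-open if $\mathfrak{a}(x)\subseteq A$ for every $x\in A$; the collection $\tau_{\mathfrak{a}}$ of all $\mathfrak{a}$-open sets is a topology on $X$ with $\tau_{\mathfrak{a}}\subseteq\tau$. The space $X$ is $\mathfrak{a}$-compact if every cover of $X$ by members of $\tau_{\mathfrak{a}}$ has a finite subcover. The same definitions apply to $(Y,\tau_Y,\mathfrak{b})$ with $\mathfrak{b}$ in place of $\mathfrak{a}$. A function $f:X\to Y$ is $\mathfrak{a}$-continuous if $f^{-1}(V)\in\tau_{\mathfrak{a}}$ for every $V\in\tau_{\mathfrak{b}}$. *)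

(* Defs.v *)
From mathcomp Require Import all_boot all_order all_classical.
From mathcomp Require Import topology.

Set Implicit Arguments.
Unset Strict Implicit.
Unset Printing Implicit Defensive.

Local Open Scope classical_set_scope.

(* An aura topological space (X, tau, a) is represented by the pair of
   X : topologicalType and a : scope X. *)
Record scope (X : topologicalType) := Scope {
  scope_fun :> X -> set X ;
  scope_open : forall x, open (scope_fun x) ;
  scope_mem : forall x, scope_fun x x
}.

Definition aura_open (X : topologicalType) (a : scope X) : set_system X :=
  [set A | forall x, A x -> a x `<=` A].

Definition aura_compact (X : topologicalType) (a : scope X) : Prop :=
  forall C : set_system X,
    C `<=` aura_open a -> \bigcup_(A in C) A = [set: X] ->
    exists D : set_system X,
      [/\ D `<=` C, finite_set D & \bigcup_(A in D) A = [set: X]].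

Definition aura_continuous (X Y : topologicalType) (a : scope X) (b : scope Y)
    (f : X -> Y) : Prop :=
  forall V : set Y, aura_open b V -> aura_open a (f @^-1` V).

Section AuraTopology.
Variables (X : topologicalType) (a : scope X).

Lemma aura_openT : aura_open a [set: X].
Proof. by []. Qed.

Lemma aura_openI : setI_closed (aura_open a).
Proof.
move=> A B oA oB x [Ax Bx] y axy.
by split; [exact: (oA x) | exact: (oB x)].
Qed.

Lemma aura_open_bigcup (I : Type) (D : set I) (F : I -> set X) :
  (forall i, D i -> aura_open a (F i)) -> aura_open a (\bigcup_(i in D) F i).
Proof. by move=> oF x [i Di Fix] y axy; exists i => //; exact: (oF i Di x). Qed.

Lemma aura_open_sub : aura_open a `<=` open.
Proof.
move=> A oA; rewrite openE => x Ax.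
apply: (filterS (oA x Ax)); apply: open_nbhs_nbhs.
by split; [exact: scope_open | exact: scope_mem].
Qed.

End AuraTopology.

(* Main.v *)
Require Import Defs.
From mathcomp Require Import all_boot all_order all_classical.
From mathcomp Require Import topology.

Local Open Scope classical_set_scope.

(** A cover [C] of [Y] by [b]-open sets pulls back along [f] to a cover of [X], which is [a]-open by
    [f_cont]. Compactness of [X] leaves finitely many preimages; their images under [f] are members
    of [C] and cover [Y] because [f] is onto. *)

Theorem theorem3p7 (X Y : topologicalType) (a : scope X) (b : scope Y)
    (f : X -> Y) (f_cont : aura_continuous a b f)
    (f_surj : set_surj [set: X] [set: Y] f) (X_compact : aura_compact a) :
  aura_compact b.
Proof.
move=> C oC covC.
(* Surjectivity in the form that [image_preimage] takes as its side condition. *)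
have fT : f @` [set: X] = [set: Y] by apply/seteqP; split.
have [|| D [DC finD covD]] := X_compact [set f @^-1` V | V in C].
- by move=> _ [V CV <-]; apply: f_cont; exact: oC.
- apply/seteqP; split=> // x _.
  have [V CV Vfx] : (\bigcup_(V in C) V) (f x) by rewrite covC.
  by exists (f @^-1` V) => //; exists V.
(* Surjectivity gives f (f^-1 V) = V, so direct images recover the members of
   C chosen by the finite subcover, with no further choice. *)
exists [set f @` U | U in D]; split.
- by move=> _ [U /DC[V CV <-] <-]; rewrite image_preimage.
- exact: finite_image.
- apply/seteqP; split=> // y _.
  have [x _ <-] := f_surj y I.
  have [U DU Ux] : (\bigcup_(U in D) U) x by rewrite covD.
  by exists (f @` U); [exists U | exists x].
Qed.
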